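(* For every finite poset model $\mathcal{F}=(W,\preccurlyeq,V_{\mathcal{F}})$ and all $w_1,w_2\in W$: $w_1\equiv_\eta w_2$ (they satisfy the same $\mathrm{SLCS}_\eta$ formulas in $\mathcal{F}$) if and only if $w_1$ and $w_2$ are weakly $\pm$-bisimilar.
   Context: A finite poset model is $(W,\preccurlyeq,V_{\mathcal{F}})$ with $(W,\preccurlyeq)$ a finite partial order and $V_{\mathcal{F}}:PL\to2^W$ for a set $PL$ of proposition letters. A $\pm$-path of length $\ell\ge2$ is $\pi:\{0,\dots,\ell\}\to W$ such that for each $i<\ell$, $\pi(i)\preccurlyeq\pi(i+1)$ or $\pi(i+1)\preccurlyeq\pi(i)$, and $\pi(0)\preccurlyeq\pi(1)$, $\pi(\ell)\preccurlyeq\pi(\ell-1)$. $\mathrm{SLCS}_\eta$ formulas: $\Phi::=p\mid\neg\Phi\mid\Phi_1\wedge\Phi_2\mid\eta(\Phi_1,\Phi_2)$; $w\models p$ iff $w\in V_{\mathcal{F}}(p)$, Boolean connectives as usual, $w\models\eta(\Phi_1,\Phi_2)$ iff there is a $\pm$-path $\pi$ of some length $\ell$ with $\pi(0)=w$, $\pi(\ell)\models\Phi_2$, $\pi(i)\models\Phi_1$ for all $i<\ell$. A symmetric relation $Z\subseteq W\times W$ is a weak $\pm$-bisimulation if whenever $Z(w_1,w_2)$: (1) $\{p:w_1\in V_{\mathcal{F}}(p)\}=\{p:w_2\in V_{\mathcal{F}}(p)\}$; (2) for all $u_1,d_1\in W$ with ($w_1\preccurlyeq u_1$ or $u_1\preccurlyeq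 w_1$) and $d_1\preccurlyeq u_1$, there is a $\pm$-path $\pi_2:\{0,\dots,\ell_2\}\to W$ with $\pi_2(0)=w_2$, $Z(d_1,\pi_2(\ell_2))$, and for all $j<\ell_2$, $Z(w_1,\pi_2(j))$ or $Z(u_1,\pi_2(j))$. $w_1,w_2$ are weakly $\pm$-bisimilar if $Z(w_1,w_2)$ for some weak $\pm$-bisimulation $Z$. *)

(* Defs.v *)
From mathcomp Require Import all_boot all_order.

Set Implicit Arguments.
Unset Strict Implicit.
Unset Printing Implicit Defensive.

Local Open Scope order_scope.

Inductive formula (PL : Type) : Type :=
  | Atom of PL
  | Neg of formula PL
  | And of formula PL & formula PL
  | Eta of formula PL & formula PL.

(* The indices wrapped by [inord] are at most l (for the last two conjuncts,
   because 2 <= l), so [inord] never falls back to its default value. *)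
Definition pm_path d (W : finPOrderType d) (l : nat) (pi : 'I_l.+1 -> W) : Prop :=
  [/\ (2 <= l)%N,
      forall i : 'I_l, pi (inord i) >=< pi (inord i.+1),
      pi ord0 <= pi (inord 1)
    & pi ord_max <= pi (inord l.-1)].

Fixpoint sat (PL : Type) d (W : finPOrderType d) (V : PL -> {set W})
    (w : W) (phi : formula PL) {struct phi} : Prop :=
  match phi with
  | Atom p => w \in V p
  | Neg phi1 => ~ sat V w phi1
  | And phi1 phi2 => sat V w phi1 /\ sat V w phi2
  | Eta phi1 phi2 =>
      exists (l : nat) (pi : 'I_l.+1 -> W),
        [/\ pm_path pi, pi ord0 = w, sat V (pi ord_max) phi2
          & forall i : 'I_l.+1, (i < l)%N -> sat V (pi i) phi1]
  end.

Definition eta_equiv (PL : Type) d (W : finPOrderType d) (V : PL -> {set W})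
    (w1 w2 : W) : Prop :=
  forall phi : formula PL, sat V w1 phi <-> sat V w2 phi.

Definition weak_pm_bisimulation (PL : Type) d (W : finPOrderType d)
    (V : PL -> {set W}) (Z : rel W) : Prop :=
  symmetric Z /\
  forall w1 w2 : W, Z w1 w2 ->
    (forall p : PL, w1 \in V p <-> w2 \in V p) /\
    (forall u1 d1 : W, w1 <= u1 \/ u1 <= w1 -> d1 <= u1 ->
      exists (l2 : nat) (pi2 : 'I_l2.+1 -> W),
        [/\ pm_path pi2, pi2 ord0 = w2, Z d1 (pi2 ord_max)
          & forall j : 'I_l2.+1, (j < l2)%N -> Z w1 (pi2 j) \/ Z u1 (pi2 j)]).

Definition weakly_pm_bisimilar (PL : Type) d (W : finPOrderType d)
    (V : PL -> {set W}) (w1 w2 : W) : Prop :=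
  exists2 Z : rel W, weak_pm_bisimulation V Z & Z w1 w2.

(* Main.v *)
(** From bisimilarity to equivalence, the point is that the bisimulation
    condition transports a whole path step by step: along [x0, x1, x2, ...] it
    is applied with [u = d = x1], then [u = d = x2], and so on, with [u] the
    last but one and [d] the last point only in the final step; the resulting
    [+-]-paths concatenate to a [+-]-path.  Conversely, logical equivalence is
    itself a bisimulation: as [W] is finite every point [x] has a characteristic
    formula [chi x], and the required path from [w2] comes from transferring
    [eta (chi w1 \/ chi u1, chi d1)] from [w1] to [w2]. *)

Require Import Defs.
From mathcomp Require Import all_boot all_order.
From mathcomp Require Import boolp.

Set Implicit Arguments.
Unset Strict Implicit.
Unset Printing Implicit Defensive.

Import Order.TTheory.
Local Open Scope order_scope.

Section Reachability.
Variables (d : Order.disp_t) (W : finPOrderType d).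
Implicit Types (P Q : W -> Prop) (w : W).

(** The clause of [Eta] with arbitrary predicates. It is convertible to [sat] of an [Eta] formula
    and to the path condition of a bisimulation, so the lemmas below serve both. *)
Definition pm_reach P Q w : Prop :=
  exists (l : nat) (pi : 'I_l.+1 -> W),
    [/\ pm_path pi, pi ord0 = w, Q (pi ord_max)
      & forall i : 'I_l.+1, (i < l)%N -> P (pi i)].

(** Indexing by [nat] lets paths be shifted and concatenated without casts between ordinals. *)
Lemma pm_reachP P Q w :
  pm_reach P Q w <->
  exists (l : nat) (f : nat -> W),
    [/\ (2 <= l)%N, forall i, (i < l)%N -> f i >=< f i.+1,
        f 0%N <= f 1%N & f l <= f l.-1] /\
    [/\ f 0%N = w, Q (f l) & forall i, (i < l)%N -> P (f i)].
Proof.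
split=> [[l [pi [[l2 cmp first final] pi0 Qpi Ppi]]] | [l [f [[l2 cmp first final] [f0 Qf Pf]]]]].
- have ord0E : inord 0 = ord0 :> 'I_l.+1 by apply/val_inj; rewrite /= inordK.
  have maxE : inord l = ord_max :> 'I_l.+1 by apply/val_inj; rewrite /= inordK.
  exists l, (fun n => pi (inord n)); rewrite ord0E maxE; split; split=> // i il.
    exact: (cmp (Ordinal il)).
  by apply: Ppi; rewrite inordK // ltnW.
- exists l, (fun i : 'I_l.+1 => f i); split=> //; last by move=> i; apply: Pf.
  split=> //= [i||].
  + by rewrite !inordK ?ltnS //; [apply: cmp | apply: ltnW].
  + by rewrite inordK // ltnS ltnW.
  + by rewrite inordK // ltnS leq_pred.
Qed.

Lemma pm_reach_mono P P' Q Q' w :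
  (forall x, P x -> P' x) -> (forall x, Q x -> Q' x) ->
  pm_reach P Q w -> pm_reach P' Q' w.
Proof.
move=> PP' QQ' [l [pi [path_pi pi0 Qpi Ppi]]].
exists l, pi; split=> //; first exact: QQ'.
by move=> i il; apply/PP'/Ppi.
Qed.

(** The junction point satisfies [P] as the start of the second path, and being interior to the
    concatenation it only needs comparable neighbours. *)
Lemma pm_reach_trans P Q w : pm_reach P (pm_reach P Q) w -> pm_reach P Q w.
Proof.
move=> /pm_reachP[l [f [[l2 cmpf ff _] [f0 + Pf]]]].
move=> /pm_reachP[m [g [[m2 cmpg _ lastg] [g0 Qg Pg]]]].
have l0 : (0 < l)%N by apply: ltnW.
apply/pm_reachP; exists (l + m)%N, (fun n => if (n < l)%N then f n else g (n - l)%N).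
split; split=> /=.
- exact: leq_trans l2 (leq_addr _ _).
- move=> i ilm; case: (ltngtP i.+1 l) => [il|li|il].
  + by apply: cmpf; apply: ltnW.
  + rewrite subSn //.
    by apply: cmpg; rewrite ltn_subLR.
  + by rewrite il subnn g0 -il; apply: cmpf; rewrite -il.
- by rewrite l0 l2.
- rewrite ltnNge leq_addr addKn /=.
  have -> : (l + m).-1 = (l + m.-1)%N by rewrite -!subn1 addnBA // ltnW.
  by rewrite ltnNge leq_addr addKn.
- by rewrite l0.
- by rewrite ltnNge leq_addr addKn.
- move=> i ilm; case: ltnP => il; first exact: Pf.
  by apply: Pg; rewrite ltn_subLR.
Qed.

(* The case [u <= w] uses the path [w, w, x], which avoids [u]. *)
Lemma pm_reach_step P Q w u x :
  w <= u \/ u <= w -> x <= u -> P w -> P u -> Q x -> pm_reach P Q w.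
Proof.
move=> wu xu Pw Pu Qx.
have [v wv [xv Pv]] : exists2 v, w <= v & x <= v /\ P v.
  by case: wu => [wu|uw]; [exists u | exists w => //; split=> //; apply: le_trans uw].
(* The default [x] of [nth] is the value at index 2, the end of the path. *)
apply/pm_reachP; exists 2%N, (nth x [:: w; v]); split; split=> //.
  by case=> [|[|]] //= _; rewrite /Order.comparable ?wv ?xv ?orbT.
by case=> [|[|]].
Qed.

End Reachability.

Section Bisimulation.
Variables (PL : Type) (d : Order.disp_t) (W : finPOrderType d) (V : PL -> {set W}).
Implicit Types (P Q : W -> Prop) (x y w : W) (phi : formula PL).

Lemma bisimulation_step (Z : rel W) x y u w :
  weak_pm_bisimulation V Z -> Z x y -> x <= u \/ u <= x -> w <= u ->
  pm_reach (fun v => Z x v \/ Z u v) (Z w) y.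
Proof. by move=> [_ bisZ] Zxy; have [_] := bisZ _ _ Zxy; apply. Qed.

Lemma bisimulation_pm_reach (Z : rel W) P Q x y :
  weak_pm_bisimulation V Z ->
  (forall u v, Z u v -> P u -> P v) -> (forall u v, Z u v -> Q u -> Q v) ->
  Z x y -> pm_reach P Q x -> pm_reach P Q y.
Proof.
move=> bisZ ZP ZQ Zxy /pm_reachP[l [f [[l2 cmp _ final] [f0 Qf Pf]]]].
have : (0 < l)%N by apply: ltnW.
(* The induction runs over suffixes of the path, which may have length 1 and need not start upwards;
   only comparability and the final descent are kept. *)
rewrite -{}f0 in Zxy; clear l2.
elim: l f y cmp final Zxy Qf Pf => // -[|l] IHl f y cmp final Zfy Qf Pf _.
  have := bisimulation_step bisZ Zfy (or_introl (lexx _)) final.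
  apply: pm_reach_mono => z; first by case=> /ZP; apply; apply: Pf.
  by move=> /ZQ; apply.
have f01 : f 0%N <= f 1%N \/ f 1%N <= f 0%N by apply/orP/cmp.
apply: pm_reach_trans.
apply: pm_reach_mono (bisimulation_step bisZ Zfy f01 (lexx _)) => z.
  by case=> /ZP; apply; apply: Pf.
move=> Zz; apply: (IHl (fun n => f n.+1)) => // i il; first exact: cmp.
exact: Pf.
Qed.

Lemma bisimulation_sat (Z : rel W) phi x y :
  weak_pm_bisimulation V Z -> Z x y -> sat V x phi -> sat V y phi.
Proof.
move=> bZ; have [symZ bisZ] := bZ.
elim: phi x y => [p|phi IH|phi1 IH1 phi2 IH2|phi1 IH1 phi2 IH2] x y Zxy /=.
- by have [/(_ p)[]] := bisZ _ _ Zxy.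
- by move=> nphi /(IH y x); apply: contra_not nphi; rewrite symZ; apply.
- by move=> [/(IH1 _ _ Zxy) ? /(IH2 _ _ Zxy)].
- exact: (bisimulation_pm_reach (P := fun w => sat V w phi1)
            (Q := fun w => sat V w phi2) bZ IH1 IH2 Zxy).
Qed.

(** Negation allows the distinguishing formula to be chosen true at [x]. *)
Lemma not_eta_equiv x y :
  ~ eta_equiv V x y -> exists2 phi, sat V x phi & ~ sat V y phi.
Proof.
move=> /existsNP[phi nphi].
have [xphi|nxphi] := pselect (sat V x phi).
  by exists phi => // yphi; apply: nphi.
by exists (Neg phi) => //= nyphi; apply: nphi; split.
Qed.

(* Without proposition letters there is no formula at all, not even [True]. *)
Lemma characteristic_formula (phi0 : formula PL) x :
  exists chi, forall y, sat V y chi <-> eta_equiv V x y.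
Proof.
suff [chi xchi chiP] : exists2 chi, sat V x chi &
    forall y, y \in enum W -> sat V y chi -> eta_equiv V x y.
  exists chi => y; split=> [|/(_ chi)[+ _]]; last exact.
  by apply: chiP; rewrite mem_enum.
(* Each listed point not equivalent to [x] contributes a conjunct true at [x] and false at that
   point. *)
elim: (enum W) => [|y s [chi xchi chiP]].
  by have [?|?] := pselect (sat V x phi0); [exists phi0 | exists (Neg phi0)].
have [xy|/not_eta_equiv[delta xdelta ydelta]] := pselect (eta_equiv V x y).
  by exists chi => // z; rewrite inE => /orP[/eqP->|/chiP].
exists (And chi delta) => // z; rewrite inE => /orP[/eqP->|/chiP zP] /= [] //.
by move=> zchi _; exact: zP zchi.
Qed.

Lemma eta_equiv_bisimulation :
  weak_pm_bisimulation V (fun x y => `[< eta_equiv V x y >]).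
Proof.
split=> [x y|w1 w2 /asboolP w12].
  by apply/asboolP/asboolP => xy phi; split=> /xy.
split=> [p|u x wu xu]; first exact: (w12 (Atom p)).
change (pm_reach (fun y => `[< eta_equiv V w1 y >] \/ `[< eta_equiv V u y >])
                 (fun y => `[< eta_equiv V x y >]) w2).
(* If there are no formulas, all points are equivalent and the constant path at [w2] suffices. *)
have [[phi0 _]|nophi] := pselect (exists phi : formula PL, True); last first.
  have equivT y z : `[< eta_equiv V y z >].
    by apply/asboolP => phi; case: nophi; exists phi.
  by apply: (pm_reach_step (u := w2) (x := w2)) => //; left.
have [chiw chiwP] := characteristic_formula phi0 w1.
have [chiu chiuP] := characteristic_formula phi0 u.
have [chix chixP] := characteristic_formula phi0 x.
(* The disjunction of [chiw] and [chiu], by De Morgan. *)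
pose chi := Neg (And (Neg chiw) (Neg chiu)).
have chiP y : sat V y chi <-> eta_equiv V w1 y \/ eta_equiv V u y.
  rewrite /= -chiwP -chiuP; split=> [/not_andP[]/contrapT|[] ? []] //; by [left|right].
have : sat V w1 (Eta chi chix).
  apply: (pm_reach_step (P := fun w => sat V w chi) (Q := fun w => sat V w chix) wu xu).
  - by apply/chiP; left.
  - by apply/chiP; right.
  - exact/chixP.
move=> /w12; apply: (@pm_reach_mono _ _ (fun w => sat V w chi) _ (fun w => sat V w chix)).
  by move=> y /chiP[] ?; [left | right]; apply/asboolP.
by move=> y /chixP ?; apply/asboolP.
Qed.

End Bisimulation.

Theorem theorem4p12 (PL : Type) (d : Order.disp_t) (W : finPOrderType d)
    (V : PL -> {set W}) (w1 w2 : W) :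
  eta_equiv V w1 w2 <-> weakly_pm_bisimilar V w1 w2.
Proof.
split=> [w12|[Z bisZ Z12] phi].
  by exists (fun x y => `[< eta_equiv V x y >]); [apply: eta_equiv_bisimulation | apply/asboolP].
have Z21 : Z w2 w1 by case: (bisZ) => ->.
by split; [apply: bisimulation_sat bisZ Z12 | apply: bisimulation_sat bisZ Z21].
Qed.
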